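(* Let $\lambda, H > 0$, $p_1,p_2\ge 0$, and let $(\varphi_1,\theta_1), (\varphi_2,\theta_2) \in [-\frac{\pi}{2},\frac{\pi}{2}]^2$ be two angle pairs. Put $\Omega = \sin(\theta_2)-\sin(\theta_1)$ and $\Psi = \cos(\theta_2)\sin(\varphi_2)-\cos(\theta_1)\sin(\varphi_1)$, and assume $\Psi\neq 0$. For $L>0$, let $\mathrm{SINR}_{1,d=0}^{\mathrm{MR}}$ and $\mathrm{SINR}_{1,d=0}^{\mathrm{ZF}}$ be the limiting SINRs of user 1 for a continuous surface of length $L$ and height $H$ under maximum ratio and zero-forcing precoding (defined in the context). Then $$\lim_{L\to\infty}\left[\log_2\left(1+\mathrm{SINR}_{1,d=0}^{\mathrm{ZF}}\right)-\log_2\left(1+\mathrm{SINR}_{1,d=0}^{\mathrm{MR}}\right)\right]=0,$$ where $\lambda$, $H$, $p_1$, $p_2$ and the angles are held fixed.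
   Context: Convention: $\mathrm{sinc}(x) = \sin(\pi x)/(\pi x)$ for $x \ne 0$ and $\mathrm{sinc}(0)=1$. The limiting SINRs of user 1 (limits of vanishing antenna size for a surface of length $L$ and height $H$, wavelength $\lambda$, and size-independent SNR factors $p_1,p_2$ of the two users) are $$\mathrm{SINR}_{1,d=0}^{\mathrm{MR}} = \frac{p_1 LH}{p_2 LH\,\mathrm{sinc}^2\left(\frac{H\Omega}{\lambda}\right)\mathrm{sinc}^2\left(\frac{L\Psi}{\lambda}\right)+1},$$ $$\mathrm{SINR}_{1,d=0}^{\mathrm{ZF}} = p_1 LH\left(1-\mathrm{sinc}^2\left(\frac{H\Omega}{\lambda}\right)\mathrm{sinc}^2\left(\frac{L\Psi}{\lambda}\right)\right).$$ *)

(* Defs.v *)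
From Stdlib Require Import Reals.
From Coquelicot Require Import Coquelicot.
Open Scope R_scope.

(* Normalized sinc. *)
Definition sinc (x : R) : R :=
  if Req_EM_T x 0 then 1 else sin (PI * x) / (PI * x).

Definition log2 (x : R) : R := ln x / ln 2.

(* Spatial frequency differences of two users with azimuths phi1, phi2 and
   elevations theta1, theta2. *)
Definition Omega (theta1 theta2 : R) : R := sin theta2 - sin theta1.

Definition Psi (phi1 theta1 phi2 theta2 : R) : R :=
  cos theta2 * sin phi2 - cos theta1 * sin phi1.

(* Limiting SINRs of user 1 as the antenna size vanishes, for a surface of
   length L and height H at wavelength lambda, under maximum ratio and
   zero-forcing precoding.  p1 and p2 are the size-independent SNR factors. *)
Definition SINR_MR (lambda H p1 p2 phi1 theta1 phi2 theta2 L : R) : R :=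
  p1 * (L * H) /
  (p2 * (L * H) * (sinc (H * Omega theta1 theta2 / lambda)) ^ 2
     * (sinc (L * Psi phi1 theta1 phi2 theta2 / lambda)) ^ 2 + 1).

(* There is no p2: zero forcing cancels the interference from user 2. *)
Definition SINR_ZF (lambda H p1 phi1 theta1 phi2 theta2 L : R) : R :=
  p1 * (L * H) *
  (1 - (sinc (H * Omega theta1 theta2 / lambda)) ^ 2
         * (sinc (L * Psi phi1 theta1 phi2 theta2 / lambda)) ^ 2).

(* Main.v *)
(** Since [Psi <> 0], [L * sinc (L * Psi / lambda) ^ 2] is O(1/L): the
    interference power stays negligible although it is multiplied by [L].
    Hence [1 + SINR] divided by [L] tends to [p1 * H] under both precodings, and
    for [p1 > 0] the difference of the logarithms tends to
    [log2 (p1 * H) - log2 (p1 * H) = 0].  For [p1 = 0] both SINRs vanish. *)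
Require Import Defs.
From Stdlib Require Import Reals Lra.
From Coquelicot Require Import Coquelicot.
Open Scope R_scope.

Lemma is_lim_inv_p_infty : is_lim (fun x : R => / x) p_infty 0.
Proof.
  apply (is_lim_inv (fun x => x) p_infty p_infty); [apply is_lim_id | easy].
Qed.

(** The numerator of [sinc] is a sine, so its square is at most 1. The bound fails at 0, where
    [sinc] is 1 but the inverse of 0 is 0. *)
Lemma sinc_sqr_le (x : R) : x <> 0 -> sinc x ^ 2 <= / (PI * x) ^ 2.
Proof.
  intros Hx. unfold sinc. destruct (Req_EM_T x 0) as [E | _]; [easy |].
  assert (HP : PI * x <> 0)
    by (apply Rmult_integral_contrapositive; split; [apply PI_neq0 | easy]).
  assert (Hp : 0 < (PI * x) ^ 2) by (apply pow2_gt_0; exact HP).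
  assert (Hs : sin (PI * x) ^ 2 <= 1).
  { pose proof (SIN_bound (PI * x)). nra. }
  replace ((sin (PI * x) / (PI * x)) ^ 2)
    with (sin (PI * x) ^ 2 * / (PI * x) ^ 2) by (field; split; [exact Hx | apply PI_neq0]).
  pose proof (Rinv_0_lt_compat _ Hp). nra.
Qed.

(** Squeeze: the square of [sinc] decays like [/ x ^ 2], which beats the factor [x] and leaves a
    constant times [/ x]. *)
Lemma is_lim_mult_sinc_sqr (c : R) :
  c <> 0 -> is_lim (fun x => x * sinc (x * c) ^ 2) p_infty 0.
Proof.
  intros Hc.
  apply is_lim_le_le_loc with (f := fun _ => 0)
    (g := fun x => / (PI * c) ^ 2 * / x).
  - exists 0. intros x Hx.
    assert (Hxc : x * c <> 0)
      by (apply Rmult_integral_contrapositive; split; [lra | easy]).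
    split.
    + apply Rmult_le_pos; [lra | apply pow2_ge_0].
    + replace (/ (PI * c) ^ 2 * / x) with (x * / (PI * (x * c)) ^ 2)
        by (field; pose proof PI_neq0; lra).
      apply Rmult_le_compat_l; [lra | now apply sinc_sqr_le].
  - apply is_lim_const.
  - replace (Finite 0) with (Rbar_mult (/ (PI * c) ^ 2) 0)
      by (simpl; f_equal; ring).
    apply is_lim_scal_l, is_lim_inv_p_infty.
Qed.

(** Dividing both arguments by [x] does not change the difference of the logarithms, and [ln] is
    continuous at [l > 0]. *)
Lemma is_lim_log2_sub (f g : R -> R) (l : R) :
  0 < l ->
  is_lim (fun x => f x / x) p_infty l ->
  is_lim (fun x => g x / x) p_infty l ->
  is_lim (fun x => log2 (f x) - log2 (g x)) p_infty 0.
Proof.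
  intros Hl Hf Hg.
  assert (Hpos : forall h, is_lim (fun x => h x / x) p_infty l ->
    Rbar_locally p_infty (fun x => 0 < h x / x)).
  (* The positive reals are a neighbourhood of [l]. *)
  { intros h Hh. apply Hh. exact (open_gt 0 l Hl). }
  assert (Hln : forall h, is_lim (fun x => h x / x) p_infty l ->
    is_lim (fun x => ln (h x / x)) p_infty (ln l)).
  { intros h Hh. apply (is_lim_comp_continuous _ ln _ _ Hh).
    apply (ex_derive_continuous (K := R_AbsRing) (V := R_NormedModule)).
    now auto_derive. }
  apply is_lim_ext_loc with (fun x => / ln 2 * (ln (f x / x) - ln (g x / x))).
  - generalize (Hpos f Hf) (Hpos g Hg). intros [M1 H1] [M2 H2].
    exists (Rmax 0 (Rmax M1 M2)). intros x Hx.
    pose proof (Rmax_l 0 (Rmax M1 M2)). pose proof (Rmax_r 0 (Rmax M1 M2)).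
    pose proof (Rmax_l M1 M2). pose proof (Rmax_r M1 M2).
    assert (Hx0 : 0 < x) by lra.
    (* With [y] written as [y / x * x], [ln_mult] splits off a term [ln x] on each side, and the two
       cancel. *)
    assert (Hmul : forall y, ln (y / x * x) = ln y).
    { intros y. f_equal. field. lra. }
    unfold log2. rewrite <- (Hmul (f x)), <- (Hmul (g x)).
    rewrite !ln_mult; [unfold Rdiv; ring | apply H2; lra | lra | apply H1; lra | lra].
  - replace (Finite 0) with (Rbar_mult (/ ln 2) (ln l - ln l))
      by (simpl; f_equal; ring).
    apply is_lim_scal_l, is_lim_minus'; now apply Hln.
Qed.

Theorem lemma4 :
  forall (lambda H p1 p2 phi1 theta1 phi2 theta2 : R),
    0 < lambda -> 0 < H -> 0 <= p1 -> 0 <= p2 ->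
    - (PI / 2) <= phi1 <= PI / 2 ->
    - (PI / 2) <= theta1 <= PI / 2 ->
    - (PI / 2) <= phi2 <= PI / 2 ->
    - (PI / 2) <= theta2 <= PI / 2 ->
    Psi phi1 theta1 phi2 theta2 <> 0 ->
    is_lim
      (fun L : R =>
         log2 (1 + SINR_ZF lambda H p1 phi1 theta1 phi2 theta2 L)
         - log2 (1 + SINR_MR lambda H p1 p2 phi1 theta1 phi2 theta2 L))
      p_infty 0.
Proof.
  intros lambda H p1 p2 phi1 theta1 phi2 theta2 Hlam HH Hp1 Hp2 _ _ _ _ HPsi.
  unfold SINR_ZF, SINR_MR.
  set (s := sinc (H * Omega theta1 theta2 / lambda) ^ 2).
  set (P := Psi phi1 theta1 phi2 theta2) in *.
  destruct Hp1 as [Hp1 | <-].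
  2: { apply is_lim_ext with (fun _ => 0); [intros L | apply is_lim_const].
       unfold Rdiv. rewrite !Rmult_0_l. ring. }
  assert (Hs : 0 <= s) by apply pow2_ge_0.
  assert (Hc : P / lambda <> 0).
  { apply Rmult_integral_contrapositive. split; [easy |].
    apply Rinv_neq_0_compat. lra. }
  set (t := fun L => sinc (L * P / lambda) ^ 2).
  assert (Ht : is_lim (fun L => L * t L) p_infty 0).
  { apply is_lim_ext with (2 := is_lim_mult_sinc_sqr _ Hc).
    intros L. unfold t, Rdiv. now rewrite Rmult_assoc. }
  apply is_lim_log2_sub with (p1 * H); [nra | |].
  (* Zero forcing: [t L] is written as [/ L * (L * t L)], a product of two factors that tend to 0,
     so that [Ht] applies. *)
  - apply is_lim_ext_loc with
      (fun L => / L + (p1 * H - p1 * H * s * (/ L * (L * t L)))).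
    + exists 0. intros L HL. fold (t L). field. lra.
    + replace (Finite (p1 * H))
        with (Finite (0 + (p1 * H - p1 * H * s * (0 * 0))))
        by (f_equal; ring).
      apply is_lim_plus'; [apply is_lim_inv_p_infty |].
      apply is_lim_minus'; [apply is_lim_const |].
      apply (is_lim_scal_l _ (p1 * H * s) p_infty (Finite (0 * 0))).
      apply (is_lim_mult _ _ p_infty 0 0);
        [apply is_lim_inv_p_infty | exact Ht | easy].
  (* Maximum ratio: [L] enters the denominator only through [L * t L], so the denominator tends to
     1. *)
  - apply is_lim_ext_loc with
      (fun L => / L + p1 * H * / (p2 * H * s * (L * t L) + 1)).
    + exists 0. intros L HL. fold (t L).
      (* This keeps the denominator at least 1, hence nonzero. *)
      assert (0 <= p2 * H * s * (L * t L)).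
      { assert (0 <= t L) by apply pow2_ge_0.
        (* Hiding the bodies keeps the squares whole: a single [sinc] factor may be negative. *)
        clearbody s t. repeat apply Rmult_le_pos; lra. }
      field. split; nra.
    + replace (Finite (p1 * H))
        with (Finite (0 + p1 * H * / (p2 * H * s * 0 + 1)))
        by (f_equal; field; lra).
      apply is_lim_plus'; [apply is_lim_inv_p_infty |].
      apply (is_lim_scal_l _ (p1 * H) p_infty (Finite (/ (p2 * H * s * 0 + 1)))).
      apply (is_lim_inv _ p_infty (Finite (p2 * H * s * 0 + 1))).
      * apply is_lim_plus'; [| apply is_lim_const].
        exact (is_lim_scal_l _ (p2 * H * s) p_infty 0 Ht).
      * intros E. injection E. lra.
Qed.
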